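(* Let $\mathbb{K}$ be in addition distributive, let $k\ge1$ be an integer, and let $\varphi:\mathbb{K}\to[0,\infty)$ be a function with $\varphi(\hat1)=1$. There exists a unique representation $\mu$ of $\varphi$ over $\mathcal{P}_k$, i.e. a unique Radon measure $\mu$ on $\mathcal{F}$ with $\mu(\mathcal{F}\setminus\mathcal{P}_k)=0$ and $\varphi(x)=\mu(\{V\in\mathcal{P}_k: x\in V\})$ for all $x\in\mathbb{K}$, if and only if $\varphi$ is a $k$-valuation.
   Context: A dcpo is a poset in which every (nonempty) directed subset has a supremum. In a dcpo, $x\ll y$ means that every directed $E$ with $y\le\sup E$ contains some $w$ with $x\le w$. A domain is a dcpo in which, for each $x$, the set $\{z: z\ll x\}$ is a directed lower set with supremum $x$. A subset $U$ is Scott open if it is an upper set and meets every directed $E$ with $\sup E\in U$. The Lawson topology has as subbase the Scott open sets together with the complements of the principal upper sets $\{z: x\le z\}$. $\mathbb{K}$ is a domain which is also a lattice with top element $\hat1$, such that $\hat1\ll\hat1$ and $\ll$ is multiplicative: $a\ll x$, $b\ll y$ imply $a\wedge b\ll x\wedge y$. $\mathcal{F}=\mathrm{OFilt}(\mathbb{K})$ is the set of Scott open filters (nonempty, down-directed Scott open sets) of $\mathbb{K}$ ordered by inclusion; it is a continuous lattice whose Lawson topology is compact Hausdorff. A Radon measure is a Borel measure, finite on compact sets, inner regular on open sets and outer regular on Borel sets. $P$ is the set of prime elements of $\mathbb{K}$: those $z\ne\hat1$ such that $\mathbb{K}\setminus\{y:y\le z\}$ is a filter or empty (equivalently $z=x\wedge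 y$ implies $z=x$ or $z=y$). For $A\subseteq\mathbb{K}$ put $\langle A\rangle=\{z: z\le a\text{ for some }a\in A\}$. $\mathcal{P}_k=\{\mathbb{K}\setminus\langle A\rangle: A\subseteq P,\ 0\le|A|\le k\}$, a compact subset of $\mathcal{F}$ (the element $\mathbb{K}$ corresponds to $A=\varnothing$). A Scott function is a function $\varphi:\mathbb{K}\to[0,\infty)$ with $\varphi(x)=\sup_{z\ll x}\varphi(z)$ for all $x$ (in particular increasing), normalized by $\varphi(\hat1)=1$. Put $\nabla_z\varphi(x)=\varphi(x)-\varphi(x\wedge z)$ and $\nabla_{z_1,\ldots,z_n}\varphi=\nabla_{z_n}(\nabla_{z_1,\ldots,z_{n-1}}\varphi)$; this depends only on $A=\{z_1,\ldots,z_n\}$ and is denoted $\nabla_A\varphi$. An increasing $\varphi$ is completely monotone if $\nabla_A\varphi\ge0$ for every nonempty finite $A$. A completely monotone Scott function $\varphi$ is a $k$-valuation if for every $(k+1)$-element subset $B$ of $\mathbb{K}$, $$\nabla_B\varphi\Bigl(\bigwedge_{\{x,y\}\subseteq B}x\vee y\Bigr)=0,$$ the meet being over all pairs of distinct elements $x,y$ of $B$. *)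

(* Defs.v *)
From HB Require Import structures.
From mathcomp Require Import all_boot all_order all_algebra finmap.
From mathcomp Require Import all_classical all_reals all_analysis.

Set Implicit Arguments.
Unset Strict Implicit.
Unset Printing Implicit Defensive.

Import Order.TTheory GRing.Theory Num.Theory.

Local Open Scope classical_set_scope.
Local Open Scope ring_scope.

Section PosetNotions.
Context {d : Order.disp_t} {T : porderType d}.
Implicit Types (E U F : set T) (x y z s : T).

Definition upper_set U := forall x y, (x <= y)%O -> U x -> U y.

Definition lower_set U := forall x y, (x <= y)%O -> U y -> U x.

Definition directed E :=
  E !=set0 /\
  forall x y, E x -> E y -> exists z, [/\ E z, (x <= z)%O & (y <= z)%O].

Definition down_directed E :=
  E !=set0 /\
  forall x y, E x -> E y -> exists z, [/\ E z, (z <= x)%O & (z <= y)%O].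

(* Suprema are handled relationally: supremums E s says that s is the least
   upper bound of E. *)
Definition way_below x y :=
  forall E s, directed E -> supremums E s -> (y <= s)%O ->
  exists w, E w /\ (x <= w)%O.

Definition scott_open U :=
  upper_set U /\
  forall E s, directed E -> supremums E s -> U s -> exists x, E x /\ U x.

Definition is_filter F := upper_set F /\ down_directed F.

Definition scott_open_filter F := scott_open F /\ down_directed F.

Definition lawson_subbase : set (set T) :=
  [set U | scott_open U \/ exists x, U = ~` [set z | (x <= z)%O]].

End PosetNotions.

Section Domains.
Context {d : Order.disp_t} (T : porderType d).

Definition is_dcpo := forall E : set T, directed E -> exists s, supremums E s.

Definition is_domain :=
  is_dcpo /\
  forall x : T, let below := [set z | way_below z x] in
    [/\ directed below, lower_set below & supremums below x].

End Domains.

Definition multiplicative_way_below {d} (K : latticeType d) :=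
  forall a b x y : K,
    way_below a x -> way_below b y -> way_below (a `&` b)%O (x `&` y)%O.

(* The poset of Scott open filters; the membership proof is squashed to bool
   so that OFilt K is a subtype of set K, from which it inherits inclusion. *)
Record OFilt {d} (K : tLatticeType d) := MkOFilt {
  ofilt_set :> set K;
  ofilt_setP : `[< scott_open_filter ofilt_set >] }.

Fact ofilt_display : Order.disp_t. Proof. exact: Order.Disp tt tt. Qed.

Section OFiltInstances.
Context {d : Order.disp_t} (K : tLatticeType d).

HB.instance Definition _ := [isSub for @ofilt_set d K].
HB.instance Definition _ := [Choice of OFilt K by <:].
HB.instance Definition _ :=
  [SubChoice_isSubPOrder of OFilt K by <: with ofilt_display].

Lemma le_ofiltE (V W : OFilt K) : (V <= W)%O = `[< (V : set K) `<=` W >].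
Proof. by []. Qed.

Lemma scott_open_filterT : scott_open_filter [set: K].
Proof.
split; split=> //.
- by move=> E s [[x Ex] _] _ _; exists x.
- by exists \top%O.
- by move=> x y _ _; exists (x `&` y)%O; rewrite leIl leIr.
Qed.

HB.instance Definition _ :=
  isPointed.Build (OFilt K) (MkOFilt (asboolT scott_open_filterT)).

(* OFilt K carries the Lawson topology of the inclusion order. *)
HB.instance Definition _ :=
  @isSubBaseTopological.Build (OFilt K) (set (OFilt K)) lawson_subbase id.

End OFiltInstances.

Notation borelType X := (g_sigma_algebraType (@open X)).

Section Radon.
Context {R : realType} {X : ptopologicalType}.
Local Open Scope ereal_scope.

Definition is_radon (mu : {measure set (borelType X) -> \bar R}) :=
  [/\ (forall C : set X, compact C -> mu C < +oo),
      (forall U : set X, open U ->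
         mu U = ereal_sup [set mu C | C in [set C | compact C /\ C `<=` U]]) &
      (forall B : set (borelType X), measurable B ->
         mu B = ereal_inf [set mu U |
                            U in [set U : set X | open U /\ B `<=` U]])].

End Radon.

Section PrimesAndPk.
Context {d : Order.disp_t} (K : tLatticeType d).

Definition prime_elt (z : K) :=
  z <> \top%O /\
  (is_filter (~` [set y | (y <= z)%O]) \/ ~` [set y | (y <= z)%O] = set0).

Definition lower_closure (A : set K) : set K :=
  [set z | exists a, A a /\ (z <= a)%O].

Definition Pk (k : nat) : set (OFilt K) :=
  [set V | exists A : {fset K},
     [/\ (forall a, a \in A -> prime_elt a), (#|` A | <= k)%N &
         (V : set K) = ~` lower_closure [set` A]]].

End PrimesAndPk.

Section Valuations.
Context {R : realType} {d : Order.disp_t} {K : tLatticeType d}.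
Implicit Types (phi : K -> R) (z x : K) (s : seq K) (A B : {fset K}).

Definition scott_function phi :=
  [/\ (forall x, 0 <= phi x),
      (forall x, (phi x)%:E =
                 ereal_sup [set (phi z)%:E | z in [set z | way_below z x]]) &
      phi \top%O = 1].

Definition nabla1 phi z : K -> R := fun x => phi x - phi (x `&` z)%O.

Definition nabla_seq phi s : K -> R := foldl nabla1 phi s.

(* By nabla_seqE below, the order in which A is enumerated is irrelevant. *)
Definition nabla phi A : K -> R := nabla_seq phi (enum_fset A).

Definition completely_monotone phi :=
  {homo phi : x y / (x <= y)%O >-> x <= y} /\
  forall A, A != fset0 -> forall x, 0 <= nabla phi A x.

Definition k_valuation (k : nat) phi :=
  [/\ scott_function phi, completely_monotone phi &
      forall B, #|` B | = k.+1 ->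
        nabla phi B
          (\meet_(x <- B) \meet_(y <- B | y != x) (x `|` y))%O = 0].

Lemma nabla1C phi z w : nabla1 (nabla1 phi z) w = nabla1 (nabla1 phi w) z.
Proof.
apply/funext => x; rewrite /nabla1 (meetAC x w z) !opprB.
by rewrite addrACA [RHS]addrACA [- _ - _]addrC.
Qed.

Lemma nabla1_id phi z : nabla1 (nabla1 phi z) z = nabla1 phi z.
Proof. by apply/funext => x; rewrite /nabla1 -meetA meetxx subrr subr0. Qed.

Lemma nabla_seq_cons phi z s :
  nabla_seq phi (z :: s) = nabla1 (nabla_seq phi s) z.
Proof.
elim: s phi => [//|w s IH] phi.
rewrite -[LHS]/(nabla_seq (nabla1 (nabla1 phi z) w) s) nabla1C.
exact: (IH (nabla1 phi w)).
Qed.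

Lemma nabla1_mem phi z s :
  z \in s -> nabla1 (nabla_seq phi s) z = nabla_seq phi s.
Proof.
elim: s => // w s IH; rewrite inE nabla_seq_cons => /orP[/eqP ->|/IH zs].
  exact: nabla1_id.
by rewrite nabla1C zs.
Qed.

Lemma nabla_seqC phi s t :
  nabla_seq (nabla_seq phi t) s = nabla_seq (nabla_seq phi s) t.
Proof.
elim: s t => [//|z s IH] t.
by rewrite nabla_seq_cons IH -nabla_seq_cons (nabla_seq_cons phi z s).
Qed.

Lemma nabla_seq_sub phi s t :
  {subset s <= t} -> nabla_seq (nabla_seq phi t) s = nabla_seq phi t.
Proof.
elim: s => [//|z s IH] st; rewrite nabla_seq_cons IH ?nabla1_mem ?st ?mem_head//.
by move=> x xs; rewrite st// inE xs orbT.
Qed.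

Lemma nabla_seqE phi s : nabla_seq phi s = nabla phi [fset z in s]%fset.
Proof.
rewrite /nabla; set t := enum_fset _.
have ts : t =i s by move=> z; rewrite in_fset.
rewrite -(@nabla_seq_sub phi t s) => [|z]; last by rewrite ts.
by rewrite nabla_seqC nabla_seq_sub// => z; rewrite ts.
Qed.

End Valuations.

Section Representation.
Context {R : realType} {d : Order.disp_t} {K : tLatticeType d}.

Definition represents (k : nat) (phi : K -> R)
    (mu : {measure set (borelType (OFilt K)) -> \bar R}) :=
  [/\ is_radon mu, mu (~` Pk k) = 0%E &
      forall x : K, (phi x)%:E = mu [set V : OFilt K | Pk k V /\ (V : set K) x]].

End Representation.

(* Main.v *)
(* Write F for [OFilt K] and [x] for {V in F : x in V}. The basic sets are the
   "scones" {V : x in V, A misses V} with A finite; a measure giving mass phi(x)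
   to every [x] gives mass nabla_A phi(x) to such a scone. Every point of a Lawson
   open set U has a neighbourhood that is a scone contained in U, so compact
   subsets of U are squeezed between finite unions of scones contained in U, and
   a Radon measure is determined by its values on the sets [x].

   Existence: testing the elements of a finite sequence one at a time yields a
   finite discrete distribution on the filters way_above(x); an ultralimit along
   longer and longer sequences is a finitely additive measure on all subsets of F.
   As F is compact Hausdorff, it can be made Radon by approximating open sets from
   inside by closed sets, and phi(x) = sup {phi(z) : z << x} ensures that [x] still
   gets mass phi(x).

   By distributivity, V lies outside P_k iff some B with k+1 elements misses V while
   all pairwise joins from B lie in V: for a maximal such set B the filters
   {y : y \/ b in V}, b in B, are complements of principal ideals of primes, and V is
   their intersection. Hence the complement of P_k is open and locally contained in
   scones whose mass nabla_B phi(meet of the pairwise joins) vanishes exactly for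
   k-valuations. *)
Require Import Defs.
From HB Require Import structures.
From mathcomp Require Import all_boot all_order all_algebra finmap.
From mathcomp Require Import all_classical all_reals all_analysis.
Import Order.TTheory GRing.Theory Num.Theory.
Import numFieldNormedType.Exports.
Local Open Scope classical_set_scope.
Local Open Scope ring_scope.

Set Implicit Arguments.
Unset Strict Implicit.
Unset Printing Implicit Defensive.

(** * The Lawson topology of Scott open filters *)

Section WayBelow.
Context {d : Order.disp_t} {T : porderType d}.
Implicit Types (x y z : T) (U E : set T).

Lemma way_belowW x y : way_below x y -> (x <= y)%O.
Proof.
move=> xy; have [||//|w [-> //]] := xy [set y] y; first split.
- by exists y.
- by move=> _ _ -> ->; exists y.
- by split=> [z ->//|z]; apply.
Qed.

Lemma le_way_below x x' y' y :
  (x <= x')%O -> way_below x' y' -> (y' <= y)%O -> way_below x y.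
Proof.
move=> xx' x'y' y'y E s dE sE ys; have [w [Ew x'w]] := x'y' E s dE sE (le_trans y'y ys).
by exists w; split=> //; exact: le_trans xx' x'w.
Qed.

Context (dom : is_domain T).

Lemma way_below_directed x : directed [set z | way_below z x].
Proof. by have [_ /(_ x)[]] := dom. Qed.

Lemma way_below_sup x : supremums [set z | way_below z x] x.
Proof. by have [_ /(_ x)[]] := dom. Qed.

Lemma scott_open_way_below U x : scott_open U -> U x ->
  exists z, way_below z x /\ U z.
Proof.
by move=> [_ oU] Ux; apply: oU Ux; [exact: way_below_directed|exact: way_below_sup].
Qed.

(** The elements lying two way-below steps under [y] form a directed set with supremum [y], so
    [way_below x y] can be tested against this set. *)
Lemma way_below_interpolate x y : way_below x y ->
  exists z, way_below x z /\ way_below z y.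
Proof.
move=> xy; pose E := [set w | exists z, way_below w z /\ way_below z y].
have dE : directed E.
  split.
    have [[z zy] _] := way_below_directed y; have [[w wz] _] := way_below_directed z.
    by exists w, z.
  move=> w w' [z [wz zy]] [z' [w'z' z'y]].
  have [_ /(_ z z' zy z'y)[u [uy zu z'u]]] := way_below_directed y.
  have [_ /(_ w w')[||v [vu wv w'v]]] := way_below_directed u.
  - exact: le_way_below zu.
  - exact: le_way_below z'u.
  - by exists v; split=> //; exists u.
have sE : supremums E y.
  split=> [w [z [/way_belowW wz /way_belowW zy]]|u ubu]; first exact: le_trans zy.
  have [_ lub] := way_below_sup y; apply: lub => z zy.
  have [_ lubz] := way_below_sup z; apply: lubz => w wz.
  by apply: ubu; exists z.
have [w [[z [wz zy]] xw]] := xy E y dE sE (lexx y).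
by exists z; split=> //; exact: le_way_below xw wz _.
Qed.

End WayBelow.

Section LawsonTopology.
Context {d : Order.disp_t} {K : tLatticeType d}.
Context (dom : is_domain K).
Context (top_compact : way_below (\top%O : K) (\top%O : K)).
Context (mult : multiplicative_way_below K).
Implicit Types (x y z a b : K) (V W : OFilt K) (A : seq K).

Lemma ofiltP V : scott_open_filter (V : set K).
Proof. exact/asboolP/(ofilt_setP V). Qed.

Lemma ofilt_up V x y : (x <= y)%O -> (V : set K) x -> (V : set K) y.
Proof. by have [[up _] _] := ofiltP V; exact: up. Qed.

Lemma ofiltI V x y : (V : set K) (x `&` y)%O <-> (V : set K) x /\ (V : set K) y.
Proof.
split=> [Vxy|[Vx Vy]].
  by split; apply: ofilt_up Vxy; rewrite ?leIl ?leIr.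
have [_ [_ /(_ x y Vx Vy)[z [Vz zx zy]]]] := ofiltP V.
by apply: ofilt_up Vz; rewrite lexI zx.
Qed.

Lemma ofilt_top V : (V : set K) \top%O.
Proof. by have [_ [[x Vx] _]] := ofiltP V; apply: ofilt_up Vx; exact: lex1. Qed.

Lemma ofilt_way_below V x : (V : set K) x -> exists z, way_below z x /\ (V : set K) z.
Proof. by have [oV _] := ofiltP V; exact: scott_open_way_below. Qed.

Lemma le_ofiltP V W : reflect ((V : set K) `<=` W) (V <= W)%O.
Proof. by rewrite le_ofiltE; exact: asboolP. Qed.

Lemma ofilt_inj V W : (V : set K) = W -> V = W.
Proof. by move=> VW; apply: val_inj. Qed.

(** Scott openness is interpolation, nonemptiness comes from [top_compact], and closure under meets
    is [mult] applied to [x = x /\ x]. *)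
Lemma way_above_ofilt x : scott_open_filter [set y | way_below x y].
Proof.
split; split.
- by move=> y z yz xy; exact: le_way_below xy yz.
- move=> E s dE sE /(way_below_interpolate dom)[z [xz zs]].
  have [w [Ew zw]] := zs E s dE sE (lexx s).
  by exists w; split=> //=; exact: le_way_below xz zw.
- by exists \top%O; exact: le_way_below (lex1 _) top_compact _.
- move=> y z /= xy xz; exists (y `&` z)%O; split; rewrite ?leIl ?leIr//=.
  by rewrite -(meetxx x); exact: mult.
Qed.

Definition way_above x : OFilt K := MkOFilt (asboolT (way_above_ofilt x)).

Definition scone x A : set (OFilt K) :=
  [set V | (V : set K) x /\ forall a, a \in A -> ~ (V : set K) a].

Lemma scone_cat x y A B : scone x A `&` scone y B = scone (x `&` y)%O (A ++ B).
Proof.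
apply/seteqP; split=> V /=.
  move=> [[Vx VA] [Vy VB]]; split; first exact/ofiltI.
  by move=> a; rewrite mem_cat => /orP[/VA|/VB].
move=> [/ofiltI[Vx Vy] VAB]; split; split=> // a aA; apply: VAB;
  by rewrite mem_cat aA ?orbT.
Qed.

(* [V : ~ V a] need not be a Lawson neighbourhood of its points: a neighbourhood
   of [V] arises only if [V] also misses some [b] way above [a]. *)
Definition avoids V A := forall a, a \in A -> exists b, way_below a b /\ ~ (V : set K) b.

(** A directed union of Scott open filters is again a Scott open filter, hence an upper bound of the
    family, so it contains the supremum. *)
Lemma scott_open_mem x : scott_open [set V : OFilt K | (V : set K) x].
Proof.
split=> [V W /le_ofiltP VW|E s [[V0 EV0] dirE] [ubs lubs] sx]; first exact: VW.
have oU : scott_open_filter (\bigcup_(V in E) (V : set K)).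
  split; split.
  - by move=> y z yz [V EV Vy]; exists V => //; exact: ofilt_up Vy.
  - move=> D t dD tD [V EV Vt]; have [[_ oV] _] := ofiltP V.
    by have [y [Dy Vy]] := oV D t dD tD Vt; exists y; split=> //; exists V.
  - by exists \top%O, V0 => //; exact: ofilt_top.
  - move=> y z [V EV Vy] [W EW Wz].
    have [U [EU /le_ofiltP VU /le_ofiltP WU]] := dirE V W EV EW.
    exists (y `&` z)%O; rewrite leIl leIr; split=> //; exists U => //.
    by apply/ofiltI; split; [exact: VU|exact: WU].
have /le_ofiltP sU : (s <= MkOFilt (asboolT oU))%O.
  by apply: lubs => V EV; apply/le_ofiltP => y Vy; exists V.
by have [V EV Vx] := sU _ sx; exists V.
Qed.

Lemma lawson_subbase_open N : lawson_subbase N -> open (N : set (OFilt K)).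
Proof.
move=> lN; exists [set N] => [_ ->|]; last by rewrite bigcup_set1.
exact: (@finI_from1 _ _ lawson_subbase id).
Qed.

(** A filter containing [a] contains all of [way_above a], while [V] does not, because of the missed
    [b]. Excluding the principal upper set of [way_above a] therefore enforces that [a] is
    missed. *)
Lemma nbhs_scone V x A : (V : set K) x -> avoids V A -> nbhs V (scone x A).
Proof.
move=> Vx; elim: A => [_|a A IH aV].
  apply: (@filterS _ _ _ [set V : OFilt K | (V : set K) x]) => //.
  apply: open_nbhs_nbhs; split=> //; apply: lawson_subbase_open; left.
  exact: scott_open_mem.
have [b [ab nVb]] := aV a (mem_head _ _).
have {}IH : nbhs V (scone x A) by apply: IH => c cA; apply: aV; rewrite inE cA orbT.
have : nbhs V (~` [set W | (way_above a <= W)%O]).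
  apply: open_nbhs_nbhs; split; last by move=> /le_ofiltP/(_ _ ab).
  by apply: lawson_subbase_open; right; exists (way_above a).
apply: filterS2 IH => W [Wx WA] aW; split=> // c; rewrite inE => /orP[/eqP->|/WA//].
move=> Wa; apply: aW; apply/le_ofiltP => y /way_belowW ay; exact: ofilt_up Wa.
Qed.

(** [V] is the directed supremum of the filters [way_above z] with [z] in [V], so a Scott open [N]
    around [V] contains one of them. *)
Lemma scott_open_ofilt (N : set (OFilt K)) V : scott_open N -> N V ->
  exists z, (V : set K) z /\ [set W : OFilt K | (W : set K) z] `<=` N.
Proof.
move=> [up oN] NV; pose E := [set way_above z | z in (V : set K)].
have dE : directed E.
  split; first by exists (way_above \top%O), \top%O => //; exact: ofilt_top.
  move=> _ _ [z Vz <-] [w Vw <-]; exists (way_above (z `&` w)%O); split.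
  - by exists (z `&` w)%O => //; exact/ofiltI.
  - by apply/le_ofiltP => y zy; exact: le_way_below (leIl _ _) zy _.
  - by apply/le_ofiltP => y wy; exact: le_way_below (leIr _ _) wy _.
have sE : supremums E V.
  split=> [_ [z Vz <-]|W ubW].
    by apply/le_ofiltP => y /way_belowW zy; exact: ofilt_up Vz.
  apply/le_ofiltP => y /ofilt_way_below[z [zy Vz]].
  by have /le_ofiltP := ubW _ (imageP _ Vz); apply.
have [_ [[z Vz <-] Nz]] := oN E V dE sE NV.
exists z; split=> // W Wz; apply: up Nz; apply/le_ofiltP => y /way_belowW zy.
exact: ofilt_up Wz.
Qed.

Lemma nbhs_ofiltP V (N : set (OFilt K)) :
  nbhs V N -> exists x A, [/\ (V : set K) x, avoids V A & scone x A `<=` N].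
Proof.
rewrite nbhsE => -[U [[D sD DU] UV] UN].
move: UV; rewrite -DU => -[B DB BV].
have BN : B `<=` N by move=> W BW; apply: UN; rewrite -DU; exists B.
have [F sF FB] := sD _ DB; rewrite -FB in BN BV.
suff : exists x A, [/\ (V : set K) x, avoids V A
    & scone x A `<=` \bigcap_(i in [set` F]) id i].
  by move=> [x [A [Vx aA xA]]]; exists x, A; split=> //; exact: subset_trans BN.
have {}sF : {in enum_fset F, forall i, lawson_subbase i /\ i V}.
  by move=> i iF; split; [have := sF i iF; rewrite inE|exact: BV].
suff : exists x A, [/\ (V : set K) x, avoids V A
    & forall i, i \in enum_fset F -> scone x A `<=` i].
  by move=> [x [A [Vx aA xA]]]; exists x, A; split=> // W xW i iF; exact: (xA i).
elim: (enum_fset F) sF => [_|N0 s IH sF].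
  by exists \top%O, [::]; split=> //; exact: ofilt_top.
have [|x [A [Vx aA xA]]] := IH; first by move=> i si; apply: sF; rewrite inE si orbT.
have {sF} [lN0 N0V] := sF N0 (mem_head _ _).
suff [y [B0 [Vy aB yB]]] : exists y B0, [/\ (V : set K) y, avoids V B0
    & scone y B0 `<=` N0].
  exists (x `&` y)%O, (A ++ B0); split; first exact/ofiltI.
    by move=> a; rewrite mem_cat => /orP[/aA|/aB].
  move=> i; rewrite inE -scone_cat => /orP[/eqP->|si] W [xW yW]; first exact: yB.
  exact: (xA i).
case: lN0 N0V => [oN0|[W ->]] N0V.
  have [z [Vz zN]] := scott_open_ofilt oN0 N0V.
  by exists z, [::]; split=> // W [Wz _]; exact: zN.
(* For a subbasic complement of the upper set of [W], missing a single [a] of [W] suffices. Choosing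
   [a] way below some [b] in [W] but not in [V] makes [V] avoid [a]. *)
have /existsNP[b /not_implyP[Wb nVb]] : ~ ((W : set K) `<=` V).
  by move=> WV; apply: N0V; exact/le_ofiltP.
have [a [ab Wa]] := ofilt_way_below Wb.
exists \top%O, [:: a]; split; first exact: ofilt_top.
  by move=> c; rewrite inE => /eqP->; exists b.
move=> Z [_ /(_ a (mem_head _ _)) nZa] /le_ofiltP WZ; exact/nZa/WZ.
Qed.

Lemma open_mem x : open [set V : OFilt K | (V : set K) x].
Proof. by apply: lawson_subbase_open; left; exact: scott_open_mem. Qed.

(** A closed substitute for the open set of filters containing [z], which need not be closed: the
    condition follows from [z] being in [V], and it forces [x] into [V] whenever [z] is way below
    [x]. *)
Lemma closed_way_above_sub z : closed [set V : OFilt K | way_above z `<=` V].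
Proof.
rewrite -openC openE => V /existsNP[b /not_implyP[zb nVb]].
have [c [zc cb]] := way_below_interpolate dom zb.
have : nbhs V (scone \top%O [:: c]).
  apply: nbhs_scone; first exact: ofilt_top.
  by move=> e; rewrite inE => /eqP->; exists b.
by apply: filterS => W [_ /(_ c (mem_head _ _)) nWc] /(_ _ zc).
Qed.

(** If [x] lies in [V] but not in [W], pick [z] in [V] way below [x]. Containing [z] and missing [z]
    are then disjoint neighbourhoods of [V] and [W]. *)
Lemma ofilt_hausdorff : hausdorff_space (OFilt K).
Proof.
have sep (V W : OFilt K) x : cluster (nbhs V) W -> (V : set K) x -> (W : set K) x.
  move=> clVW Vx; apply: contrapT => nWx; have [z [zx Vz]] := ofilt_way_below Vx.
  have [||U [[Uz _] [_ /(_ z (mem_head _ _))]]//] :=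
    clVW (scone z [::]) (scone \top%O [:: z]).
  - exact: nbhs_scone.
  - apply: nbhs_scone; first exact: ofilt_top.
    by move=> e; rewrite inE => /eqP->; exists x.
move=> V W clVW; apply: ofilt_inj; apply/seteqP; split=> x; first exact: sep.
by apply: sep => A B WA VB; rewrite setIC; exact: clVW.
Qed.

(* An ultrafilter [F] converges to the filter of those [x] having some [z] way
   below them which belongs to [F]-almost all [V]. *)
Lemma ofilt_compact : compact [set: OFilt K].
Proof.
rewrite compact_ultra => F FU _; pose mem z := [set V : OFilt K | (V : set K) z].
pose L := [set x | exists z, way_below z x /\ F (mem z)].
have oL : scott_open_filter L.
  split; split.
  - by move=> x y xy [z [zx Fz]]; exists z; split=> //; exact: le_way_below zx xy.
  - move=> E s dE sE [z [/(way_below_interpolate dom)[y [zy ys]] Fz]].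
    have [w [Ew yw]] := ys E s dE sE (lexx s).
    by exists w; split=> //; exists z; split=> //; exact: le_way_below zy yw.
  - exists \top%O, \top%O; split=> //; apply: filterS filterT => V _.
    exact: ofilt_top.
  - move=> x y [z [zx Fz]] [w [wy Fw]]; exists (x `&` y)%O; rewrite leIl leIr.
    split=> //; exists (z `&` w)%O; split; first exact: mult.
    by apply: filterS2 Fz Fw => V Vz Vw; exact/ofiltI.
exists (MkOFilt (asboolT oL)); split=> // N /nbhs_ofiltP[x [A [[z [zx Fz]] aA xA]]].
apply: filterS xA _; elim: A aA => [_|a A IH aA].
  by apply: filterS Fz => V Vz; split=> //; exact: ofilt_up (way_belowW zx) Vz.
have {}IH : F (scone x A) by apply: IH => c cA; apply: aA; rewrite inE cA orbT.
have [b [ab nLb]] := aA a (mem_head _ _).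
have [Fa|Fa] := in_ultra_setVsetC (mem a) FU; first by case: nLb; exists a.
apply: filterS2 IH Fa => V [Vx VA] nVa; split=> // c.
by rewrite inE => /orP[/eqP->|/VA].
Qed.

End LawsonTopology.

(** * Radon measures from finitely additive ones *)

(** If [G C] failed, the sets [N] with [G (C \ N)] would form a proper filter, and its cluster point
    in [C] would contradict the local hypothesis. *)
Lemma compact_ind (X : topologicalType) (G : set (set X)) (C : set X) :
  compact C -> G set0 -> (forall M N, G M -> G N -> G (M `|` N)) ->
  (forall M N, M `<=` N -> G N -> G M) ->
  (forall p, C p -> exists2 N, nbhs p N & G N) -> G C.
Proof.
move=> cC G0 GU GS Gloc; apply: contrapT => nGC.
pose F : set_system X := [set N | G (C `\` N)].
have FF : ProperFilter F.
  apply: Build_ProperFilter_ex => [N FN|].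
    by apply/set0P/eqP => N0; apply: nGC; move: FN; rewrite /F/= N0 setD0.
  split=> [|M N FM FN|M N MN].
  - by rewrite /F/= setDT.
  - by rewrite /F/= setDIr; exact: GU.
  - by apply: GS => p [Cp nNp]; split=> // /MN.
have [|p [Cp clp]] := cC F FF; first by rewrite /F/= setDv.
have [N pN GN] := Gloc p Cp.
have [|x [nNx Nx]] := clp (~` N) N _ pN; last exact: nNx.
by apply: GS GN => x [_] /contrapT.
Qed.

(* A finitely additive finite measure [m] on all subsets of a compact Hausdorff
   space is turned into a Radon measure by inner approximation of open sets by
   closed sets, followed by outer approximation by open sets. *)
Section Radonization.
Context {R : realType} {X : ptopologicalType} (m : set X -> R).
Context (hausX : hausdorff_space X).
Context (compX : compact [set: X]).
Context (m_ge0 : forall A, 0 <= m A).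
Context (mU : forall A B, A `&` B = set0 -> m (A `|` B) = m A + m B).
Implicit Types (A B C D U V E : set X).
Local Open Scope ereal_scope.

Let m0 : m set0 = 0%R.
Proof.
have := mU (setI0 set0); rewrite setU0 => /eqP.
by rewrite -subr_eq0 opprD addrA subrr sub0r oppr_eq0 => /eqP.
Qed.

Let le_m A B : A `<=` B -> (m A <= m B)%R.
Proof.
move=> AB; rewrite -(setDUK AB) mU ?lerDl//.
by apply/seteqP; split=> x // [Ax []].
Qed.

Let mU_le A B : (m (A `|` B) <= m A + m B)%R.
Proof.
rewrite -(setDUK (@subsetUl _ A B)) mU.
  by rewrite lerD2l le_m// => x [[]].
by apply/seteqP; split=> x // [Ax []].
Qed.

Let closed_compact C : closed C -> compact C.
Proof. by move=> cC; exact: subclosed_compact cC compX _. Qed.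

Definition inner_content U :=
  ereal_sup [set (m C)%:E | C in [set C | closed C /\ C `<=` U]].

Lemma inner_contentP U x :
  (inner_content U <= x) <-> (forall C, closed C -> C `<=` U -> (m C)%:E <= x).
Proof.
split=> [Ux C cC CU|h]; last by apply: ge_ereal_sup => _ [C [cC CU] <-]; exact: h.
by apply: le_trans Ux; apply: ereal_sup_ubound; exists C.
Qed.

Lemma inner_content_ge C U : closed C -> C `<=` U -> (m C)%:E <= inner_content U.
Proof. by move=> cC CU; exact/((inner_contentP U _).1 _ C). Qed.

Lemma inner_content_ge0 U : 0 <= inner_content U.
Proof. by rewrite -[0]/(0%R%:E) -m0; apply: inner_content_ge => //; exact: closed0. Qed.

Lemma le_inner_content U V : U `<=` V -> inner_content U <= inner_content V.
Proof.
by move=> UV; apply/inner_contentP => C cC CU; apply: inner_content_ge => // x /CU/UV.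
Qed.

Lemma inner_content0 : inner_content set0 = 0.
Proof.
apply/eqP; rewrite eq_le inner_content_ge0 andbT; apply/inner_contentP => C _.
by rewrite subset0 => ->; rewrite m0.
Qed.

Lemma inner_content_fin U : inner_content U \is a fin_num.
Proof.
rewrite ge0_fin_numE ?inner_content_ge0//; apply: (@le_lt_trans _ _ (m setT)%:E).
  by apply/inner_contentP => C _ _; rewrite lee_fin le_m.
exact: ltry.
Qed.

(** Reduces countable subadditivity of [inner_content] to finite subadditivity of [m]. Locally,
    regularity provides a neighbourhood whose closure lies in one [U n]; finitely many of these are
    merged index by index. *)
Lemma closed_cover_shrink C (U : nat -> set X) :
    closed C -> (forall n, open (U n)) -> C `<=` \bigcup_n U n ->
  exists D : nat -> set X, (forall n, closed (D n) /\ D n `<=` U n) /\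
    exists N, C `<=` \bigcup_(n < N) D n.
Proof.
move=> cC oU CU.
pose G M := exists D : nat -> set X, (forall n, closed (D n) /\ D n `<=` U n) /\
  exists N, M `<=` \bigcup_(n < N) D n.
apply: (@compact_ind _ G) (closed_compact cC) _ _ _ _.
- exists (fun=> set0); split=> [n|]; last by exists 0%N.
  by split=> //; exact: closed0.
- move=> M M' [D [DU [N MD]]] [D' [DU' [N' MD']]].
  exists (fun n => D n `|` D' n); split=> [n|].
    have [[? ?] [? ?]] := (DU n, DU' n).
    by split; [exact: closedU|rewrite subUset].
  exists (maxn N N') => x [/MD|/MD'] [n /= nN Dx]; exists n.
  + by rewrite /= leq_max nN.
  + by left.
  + by rewrite /= leq_max nN orbT.
  + by right.
- move=> M N MN [D [DU [k ND]]]; exists D; split=> //; exists k.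
  exact: subset_trans ND.
- move=> p /CU[n _ Up].
  have [B pB BU] : exists2 B, nbhs p B & closure B `<=` U n.
    apply: (compact_regular hausX compX); first exact: filterT.
    exact: open_nbhs_nbhs.
  exists B => //; exists (fun k => if k == n then closure B else set0).
  split=> [k|].
    by case: eqP => [->|_]; split=> //; [exact: closed_closure|exact: closed0].
  exists n.+1 => x Bx; exists n => //=; rewrite eqxx; exact: subset_closure.
Qed.

Lemma inner_content_bigcup (U : nat -> set X) : (forall n, open (U n)) ->
  inner_content (\bigcup_n U n) <= \sum_(n <oo) inner_content (U n).
Proof.
move=> oU; apply/inner_contentP => C cC CU.
have [D [DU [N CD]]] := closed_cover_shrink cC oU CU.
apply: (@le_trans _ _ (\sum_(0 <= n < N) inner_content (U n))); last first.
  by apply: nneseries_lim_ge => n _ _; exact: inner_content_ge0.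
apply: (@le_trans _ _ (\sum_(0 <= n < N) (m (D n))%:E)); last first.
  by apply: lee_sum => n _; have [? ?] := DU n; exact: inner_content_ge.
rewrite sumEFin lee_fin; move: CD; rewrite bigcup_mkord => /le_m/le_trans; apply.
rewrite big_mkord; elim/big_ind2 : _ => //; first by rewrite m0.
by move=> A x B y Ax By; apply: le_trans (mU_le _ _) _; exact: lerD.
Qed.

Definition outer_content E :=
  ereal_inf [set inner_content U | U in [set U | open U /\ E `<=` U]].

Lemma outer_content_le E U : open U -> E `<=` U -> outer_content E <= inner_content U.
Proof. by move=> oU EU; apply: ereal_inf_lbound; exists U. Qed.

Lemma outer_content_ge E x :
  (forall U, open U -> E `<=` U -> x <= inner_content U) -> x <= outer_content E.
Proof. by move=> h; apply: le_ereal_inf_tmp => _ [U [oU EU] <-]; exact: h. Qed.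

Lemma outer_content_open U : open U -> outer_content U = inner_content U.
Proof.
move=> oU; apply/eqP; rewrite eq_le outer_content_le//=.
by apply: outer_content_ge => V _; exact: le_inner_content.
Qed.

Let outer_ge0 E : 0 <= outer_content E.
Proof. by apply: outer_content_ge => U _ _; exact: inner_content_ge0. Qed.

Let outer0 : outer_content set0 = 0.
Proof. by rewrite outer_content_open ?inner_content0//; exact: open0. Qed.

Let le_outer : {homo outer_content : A B / A `<=` B >-> A <= B}.
Proof.
move=> A B AB; apply: outer_content_ge => U oU BU; apply: outer_content_le => //.
exact: subset_trans BU.
Qed.

Let outer_fin E : outer_content E \is a fin_num.
Proof.
rewrite ge0_fin_numE ?outer_ge0//; apply: (@le_lt_trans _ _ (inner_content setT)).
  by apply: outer_content_le => //; exact: openT.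
by rewrite -ge0_fin_numE ?inner_content_ge0 ?inner_content_fin.
Qed.

Let outer_sigma_subadditive : sigma_subadditive outer_content.
Proof.
move=> E; apply/lee_addgt0Pr => _ /posnumP[e].
apply: le_trans (epsilon_trick _ _ _) => //=.
have /choice[U UP] n : exists U, [/\ open U, E n `<=` U
    & inner_content U <= outer_content (E n) + (e%:num / (2 ^ n.+1)%:R)%:E].
  have [|_ [U [oU EU] <-] /ltW] := @lb_ereal_inf_adherent R _
    (e%:num / (2 ^ n.+1)%:R)%R _ (outer_fin (E n)); last by exists U.
  by rewrite divr_gt0// ltr0n expn_gt0.
apply: (@le_trans _ _ (\sum_(n <oo) inner_content (U n))); last first.
  apply: lee_nneseries => n _ => [_|]; first exact: inner_content_ge0.
  by have [] := UP n.
apply: le_trans (inner_content_bigcup _); last by move=> n; have [] := UP n.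
apply: outer_content_le; last by apply: subset_bigcup => n _; have [] := UP n.
by apply: bigcup_open => n _; have [] := UP n.
Qed.

Let outerM : {outer_measure set X -> \bar R} := HB.pack outer_content
  (isOuterMeasure.Build R X outer_content outer0 outer_ge0 le_outer
     outer_sigma_subadditive).

(** Given an open [V] containing [E], first approximate [V /\ U] by a closed [C], then [V \ C] by a
    closed [D]. As [C] and [D] are disjoint closed subsets of [V], additivity of [m] bounds the sum
    by the inner content of [V]. *)
Let open_caratheodory U : open U -> caratheodory_measurable outerM U.
Proof.
move=> oU; apply: le_caratheodory_measurable => E /=.
apply: outer_content_ge => V oV EV.
apply: (@le_trans _ _ (inner_content (V `&` U) + outer_content (E `&` ~` U))).
  rewrite leeD2r//; apply: outer_content_le; first exact: openI.
  exact: setSI.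
rewrite -leeBrDr//; apply/inner_contentP => C cC CVU; rewrite leeBrDr//.
apply: (@le_trans _ _ ((m C)%:E + inner_content (V `&` ~` C))).
  rewrite leeD2l//; apply: outer_content_le.
    by apply: openI => //; exact: closed_openC.
  by move=> x [/EV Vx nUx]; split=> // /CVU[].
rewrite addeC -leeBrDr//; apply/inner_contentP => D cD DVC; rewrite leeBrDr//.
rewrite -EFinD -mU; last by apply/seteqP; split=> // x [/DVC[]].
by apply: inner_content_ge; [exact: closedU|move=> x [/DVC[]|/CVU[]]].
Qed.

Lemma radon_extension : exists mu : {measure set (borelType X) -> \bar R},
  is_radon mu /\ forall U : set X, open U -> mu U = inner_content U.
Proof.
have sub_car (B : set (borelType X)) : measurable B -> caratheodory_measurable outerM B.
  apply: (@smallest_sub _ (@sigma_algebra _ [set: X]) _ (caratheodory_measurable outerM)).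
    exact: (@sigma_algebra_measurable _ (caratheodory_type outerM)).
  exact: open_caratheodory.
have sadd : semi_sigma_additive (outer_content : set (borelType X) -> \bar R).
  move=> A mA tA mbA.
  apply: (@caratheodory_measure_sigma_additive _ _ outerM) => // [n|]; exact: sub_car.
pose mu : {measure set (borelType X) -> \bar R} := HB.pack outer_content
  (isMeasure.Build _ (borelType X) R outer_content outer0 outer_ge0 sadd).
exists mu; have muE B : mu B = outer_content B by [].
split=> [|U oU]; last exact: outer_content_open.
split=> [C cC|U oU|B mB].
- by rewrite muE ltey_eq outer_fin.
- rewrite muE; apply/eqP; rewrite eq_le; apply/andP; split; last first.
    by apply: ge_ereal_sup => _ [C [_ CU] <-]; exact: le_outer.
  rewrite outer_content_open//; apply/inner_contentP => C cC CU.
  apply: (@le_trans _ _ (mu C)); last first.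
    by apply: ereal_sup_ubound; exists C => //; split=> //; exact: closed_compact.
  (* Every open set around the closed [C] has inner content at least [m C], so closed sets do not
     lose mass in passing from [m] to [mu]. *)
  by apply: outer_content_ge => V _ CV; exact: inner_content_ge.
- rewrite muE; congr ereal_inf; apply/seteqP; split=> _ [U [oU BU] <-];
    by exists U => //; rewrite ?muE outer_content_open.
Qed.

End Radonization.

(** * Finitely additive measures from completely monotone functions *)

(** The image ultrafilter lives on a compact segment, and a cluster point of an ultrafilter is a
    limit. *)
Lemma ultra_bounded_cvg (R : realType) (T : Type) (F : set_system T) (f : T -> R) (a b : R) :
  UltraFilter F -> (forall x, a <= f x <= b) -> cvg (f x @[x --> F]).
Proof.
move=> FU fab; have PF : ProperFilter (f x @[x --> F]) by exact: fmap_proper_filter.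
have [|p [_ clp]] := @segment_compact R a b (f x @[x --> F]) PF.
  by apply: (@filterE _ F) => x; rewrite /= in_itv/= fab.
apply/cvg_ex; exists p => N pN.
have [//|FN] := in_ultra_setVsetC (f @^-1` N) FU.
by have [x []] := clp (~` N) N FN pN.
Qed.

Section TreeContent.
Context {R : realType} {d : Order.disp_t} {K : tLatticeType d} {X : Type}.
Context (w : K -> X).
Implicit Types (x y z : K) (S : seq K) (psi phi : K -> R) (D : set X).

(** Sequences, the empty one included, encode nonnegativity together with complete monotonicity in a
    form inherited by [nabla1 psi z]. *)
Definition all_nabla_ge0 psi := forall S x, 0 <= nabla_seq psi S x.

Lemma all_nabla_ge0_nabla1 psi z : all_nabla_ge0 psi -> all_nabla_ge0 (nabla1 psi z).
Proof. by move=> h S x; exact: (h (z :: S)). Qed.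

(* For [x = \top], the mass of [D] under the discrete distribution on [w @` K]
   obtained by testing membership of the elements of [S] one after the other:
   [psi y] is the mass of the filters that contain [y] and avoid the elements
   already rejected, and a leaf [x] stands for its principal filter. *)
Fixpoint tree_content S x psi D : R :=
  if S is s :: S' then
    tree_content S' (x `&` s)%O psi D + tree_content S' x (nabla1 psi s) D
  else if `[< D (w x) >] then psi x else 0.

Lemma tree_content_ge0 S x psi D : all_nabla_ge0 psi -> 0 <= tree_content S x psi D.
Proof.
elim: S x psi => [|s S IH] x psi h /=; first by case: ifP => // _; exact: (h [::]).
by rewrite addr_ge0 ?IH//; exact: all_nabla_ge0_nabla1.
Qed.

Lemma tree_contentT S x psi : tree_content S x psi setT = psi x.
Proof.
elim: S x psi => [|s S IH] x psi /=; first by rewrite asboolT.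
by rewrite !IH /nabla1 addrC subrK.
Qed.

Lemma tree_contentU S x psi A B : A `&` B = set0 ->
  tree_content S x psi (A `|` B) = tree_content S x psi A + tree_content S x psi B.
Proof.
move=> AB; elim: S x psi => [|s S IH] x psi /=; last by rewrite !IH addrACA.
case: (asboolP (A (w x))) => Ax; case: (asboolP (B (w x))) => Bx.
- by have : (A `&` B) (w x) by []; rewrite AB.
- by rewrite asboolT ?addr0//; left.
- by rewrite asboolT ?add0r//; right.
- by rewrite asboolF ?addr0// => -[].
Qed.

(** Once [z] has been accepted, all later leaves are below [z] and so count towards [D]. The branch
    rejecting [z] contributes a nonnegative amount, which is dropped. *)
Lemma tree_content_ge S x psi D z : all_nabla_ge0 psi ->
  (forall y, (y <= z)%O -> D (w y)) -> (x <= z)%O \/ z \in S ->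
  psi (x `&` z)%O <= tree_content S x psi D.
Proof.
move=> + Dz; elim: S x psi => [|s S IH] x psi h xzS /=.
  by have [xz|//] := xzS; rewrite asboolT; [rewrite (meet_l xz)|exact: Dz].
have h' := all_nabla_ge0_nabla1 s h.
have [xzS'|zs] : ((x <= z)%O \/ z \in S) \/ z = s.
- case: xzS => [|]; first by left; left.
  by rewrite inE => /orP[/eqP|]; [right|left; right].
- apply: (@le_trans _ _ (psi (x `&` s `&` z)%O + nabla1 psi s (x `&` z)%O)).
    by rewrite /nabla1 (meetAC x s z) addrC subrK.
  apply: lerD; last by apply: IH => //; exact: all_nabla_ge0_nabla1.
  by apply: IH => //; case: xzS' => [/(le_trans (leIl x s))|]; [left|right].
- subst s; rewrite -[leLHS]addr0; apply: lerD; last first.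
    by apply: tree_content_ge0; exact: all_nabla_ge0_nabla1.
  by rewrite -{1}(meetxx z) meetA; apply: IH => //; left; exact: leIr.
Qed.

(** The third alternative is the state after [z] has been rejected: [psi] then vanishes below [z],
    so that branch contributes nothing to [D]. *)
Lemma tree_content_le S x psi D z : all_nabla_ge0 psi ->
  (forall y, D (w y) -> (y <= z)%O) ->
  [\/ (x <= z)%O, z \in S | forall y, (y <= z)%O -> psi y = 0] ->
  tree_content S x psi D <= psi (x `&` z)%O.
Proof.
move=> + Dz; elim: S x psi => [|s S IH] x psi h xzS /=.
  case: asboolP => [/Dz xz|_]; last exact: (h [::]).
  by rewrite (meet_l xz).
have h' := all_nabla_ge0_nabla1 s h.
have nabla1_le y : (y <= s)%O -> nabla1 psi s y = 0.
  by move=> ys; rewrite /nabla1 (meet_l ys) subrr.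
have [xzS'|zs] : [\/ (x <= z)%O, z \in S | forall y, (y <= z)%O -> psi y = 0] \/ z = s.
- case: xzS => [xz||z0]; [by left; constructor 1| |by left; constructor 3].
  by rewrite inE => /orP[/eqP|zS]; [right|left; constructor 2].
- apply: (@le_trans _ _ (psi (x `&` s `&` z)%O + nabla1 psi s (x `&` z)%O)); last first.
    by rewrite /nabla1 (meetAC x s z) addrC subrK.
  apply: lerD; apply: IH => //.
    case: xzS' => [/(le_trans (leIl x s)) xz|zS|z0].
    + by constructor 1.
    + by constructor 2.
    + by constructor 3.
  case: xzS' => [xz|zS|z0]; [by constructor 1|by constructor 2|constructor 3].
  move=> y yz; rewrite /nabla1 !z0 ?subrr//.
  exact: le_trans (leIl _ _) yz.
- subst s; rewrite -[leRHS]addr0 -(nabla1_le (x `&` z)%O (leIr _ _)); apply: lerD.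
    by rewrite -{2}(meetxx z) meetA IH//; constructor 1; exact: leIr.
  by apply: IH => //; constructor 3.
Qed.

(* The content is the limit of [tree_content S \top phi] along an ultrafilter of
   sequences [S] that eventually contain each element of [K]. *)
Lemma finitely_additive_content phi : all_nabla_ge0 phi ->
  exists m : set X -> R, [/\ forall A, 0 <= m A,
    forall A B, A `&` B = set0 -> m (A `|` B) = m A + m B,
    forall z D, (forall y, (y <= z)%O -> D (w y)) -> phi z <= m D &
    forall z D, (forall y, D (w y) -> (y <= z)%O) -> m D <= phi z].
Proof.
move=> h; pose B S0 := [set S : seq K | {subset S0 <= S}].
have PB : ProperFilter (filter_from [set: seq K] B).
  apply: filter_from_proper; last by move=> S _; exists S => x.
  apply: filter_from_filter; first by exists [::].
  move=> S S' _ _; exists (S ++ S') => // T sT.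
  by split=> x xS; apply: sT; rewrite mem_cat xS ?orbT.
have [F [FU BF]] := ultraFilterLemma PB.
have memF z : F [set S | z \in S].
  by apply: BF; exists [:: z] => // S; apply; exact: mem_head.
pose t D S := tree_content S \top%O phi D.
have t_ge0 D S : 0 <= t D S by exact: tree_content_ge0.
have t_cvg D : cvg (t D S @[S --> F]).
  apply: (@ultra_bounded_cvg _ _ _ _ 0 (phi \top%O)) => S; rewrite t_ge0/=.
  rewrite -(tree_contentT S) -(setUv D) tree_contentU ?setICr// lerDl.
  exact: tree_content_ge0.
exists (fun D => lim (t D S @[S --> F])); split=> [A|A A' AA'|z D Dz|z D Dz].
- by apply: limr_ge => //; exact: nearW.
- rewrite -limD//; congr (lim (_ @ F)); apply/funext => S.
  exact: tree_contentU.
- apply: limr_ge => //; apply: filterS (memF z) => S zS.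
  rewrite -[z in phi z]meet1x; apply: tree_content_ge => //; by right.
- apply: limr_le => //; apply: filterS (memF z) => S zS.
  rewrite -[z in phi z]meet1x; apply: tree_content_le => //; by constructor 2.
Qed.

End TreeContent.

(** * Finite intersections of prime filters *)

Section PrimeIntersections.
Context {d : Order.disp_t} {K : tDistrLatticeType d}.
Context (dom : is_domain K).
Context (top_compact : way_below (\top%O : K) (\top%O : K)).
Context (mult : multiplicative_way_below K).
Implicit Types (x y z a b : K) (V W : OFilt K) (A B : seq K) (k n : nat).

Definition pair_joins B : K := (\meet_(x <- B) \meet_(y <- B | y != x) (x `|` y))%O.

Lemma ofilt_bigmeet V (I : Type) (s : seq I) (P : pred I) (F : I -> K) :
  (V : set K) (\meet_(i <- s | P i) F i)%O <->
  all (fun i => P i ==> `[< (V : set K) (F i) >]) s.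
Proof.
elim: s => [|i s IH]; first by rewrite big_nil; split=> // _; exact: ofilt_top.
rewrite big_cons /=; case: (P i) => //=; split.
  by move=> /ofiltI[/asboolP-> /IH].
by move=> /andP[/asboolP VF /IH Vs]; exact/ofiltI.
Qed.

Lemma ofilt_pair_joins V B : (V : set K) (pair_joins B) <->
  {in B &, forall x y, y != x -> (V : set K) (x `|` y)%O}.
Proof.
split=> [/ofilt_bigmeet/allP VB x y xB yB yx|VB].
  by have /asboolP/ofilt_bigmeet/allP/(_ y yB)/implyP/(_ yx)/asboolP := VB x xB.
apply/ofilt_bigmeet/allP => x xB; apply/asboolP/ofilt_bigmeet/allP => y yB.
by apply/implyP => yx; apply/asboolP; exact: VB.
Qed.

Definition scattered V B :=
  [/\ uniq B, {in B, forall b, ~ (V : set K) b} & (V : set K) (pair_joins B)].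

(** Joining with [b] preserves directed suprema, so Scott openness of [V] applies to the image of
    [E]. *)
Lemma scott_open_joinl V b E s : directed E -> supremums E s ->
  (V : set K) (s `|` b)%O -> exists x, E x /\ (V : set K) (x `|` b)%O.
Proof.
move=> [[x0 Ex0] dE] [ubs lubs] Vsb; have [[_ oV] _] := ofiltP V.
have [||//|_ [[x Ex <-] Vx]] := oV [set (x `|` b)%O | x in E] (s `|` b)%O.
- split; first by exists (x0 `|` b)%O, x0.
  move=> _ _ [x Ex <-] [y Ey <-]; have [z [Ez xz yz]] := dE x y Ex Ey.
  by exists (z `|` b)%O; split; [exists z|exact: leU2|exact: leU2].
- split=> [_ [x Ex <-]|u ubu]; first by apply: leU2 => //; exact: ubs.
  rewrite leUx; apply/andP; split.
    by apply: lubs => x Ex; apply: le_trans (leUl x b) _; apply: ubu; exists x.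
  by apply: le_trans (leUr b x0) _; apply: ubu; exists x0.
by exists x.
Qed.

(* In a scattered set of maximal size, [b] cannot be split into two elements
   [y `|` b] and [z `|` b]; hence [y `|` b \in V] is a prime condition on [y]. *)
Lemma scattered_prime V B b : scattered V B ->
    (forall B', scattered V B' -> (size B' <= size B)%N) -> b \in B ->
  exists a, prime_elt a /\ forall y, (V : set K) (y `|` b)%O <-> ~ (y <= a)%O.
Proof.
move=> [uB nVB /ofilt_pair_joins VB] maxB bB.
pose I : set K := [set y | ~ (V : set K) (y `|` b)%O].
have IU y z : I y -> I z -> I (y `|` z)%O.
  (* Exchanging [b] for the two elements of the split would give a scattered sequence with one more
     entry. *)
  move=> Iy Iz Vyzb; pose B' := [:: y `|` b, z `|` b & rem b B]%O.
  have Vyz : (V : set K) ((y `|` b) `|` (z `|` b))%O by rewrite joinACA joinxx.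
  have Vc w c : c \in rem b B -> (V : set K) ((w `|` b) `|` c)%O.
    rewrite mem_rem_uniq// inE => /andP[cb cB].
    by apply: ofilt_up (VB b c bB cB cb); rewrite -joinA leUr.
  have neq u v : ~ (V : set K) u -> (V : set K) (u `|` v)%O -> u != v.
    by move=> nVu Vuv; apply/eqP => uv; move: Vuv; rewrite -uv joinxx.
  have : (size B' <= size B)%N.
    apply: maxB; split.
    - have notin w : I w -> (w `|` b)%O \notin rem b B.
        by move=> Iw; apply/negP => /(Vc w); rewrite joinxx.
      by rewrite /= rem_uniq// inE negb_or neq//= !notin.
    - by move=> c; rewrite !inE => /or3P[/eqP->|/eqP->|/mem_rem/nVB].
    - apply/ofilt_pair_joins => c e; rewrite !inE.
      move=> /or3P[/eqP->|/eqP->|cB] /or3P[/eqP->|/eqP->|eB]; rewrite ?eqxx//.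
      + by move=> _; exact: Vc.
      + by move=> _; rewrite joinC.
      + by move=> _; exact: Vc.
      + by rewrite (joinC c) => _; exact: Vc.
      + by rewrite (joinC c) => _; exact: Vc.
      + by move=> ec; apply: (VB _ _ (mem_rem cB) (mem_rem eB)).
  have B0 : (0 < size B)%N by case: B bB {VB nVB uB maxB B' Vc}.
  by rewrite /= size_rem// prednK// ltnn.
have Ilow y z : (y <= z)%O -> I z -> I y.
  by move=> yz Iz Vy; apply: Iz; apply: ofilt_up Vy; exact: leU2.
have dI : directed I.
  split; first by exists b; rewrite /I/= joinxx; exact: nVB.
  by move=> y z Iy Iz; exists (y `|` z)%O; rewrite leUl leUr; split=> //; exact: IU.
(* The ideal [I] contains its own supremum by [scott_open_joinl], so it is the principal ideal of
   [a]. *)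
have [a supa] := dom.1 I dI.
have Ia : I a by move=> /(scott_open_joinl dI supa)[x []].
have IaE y : (V : set K) (y `|` b)%O <-> ~ (y <= a)%O.
  split=> [Vy /Ilow/(_ Ia)//|nya]; apply: contrapT => Iy; apply: nya.
  exact: supa.1.
exists a; split=> //; split.
  by move=> aT; apply: Ia; rewrite aT join1x; exact: ofilt_top.
left; split=> [y z yz nya za|]; first exact/nya/(le_trans yz).
split; first by exists \top%O; apply/IaE; rewrite join1x; exact: ofilt_top.
move=> y z /IaE Vy /IaE Vz; exists (y `&` z)%O; rewrite leIl leIr; split=> //.
(* Distributivity turns primeness of [a] into closure of [V] under meets. *)
by apply/IaE; rewrite joinIl; exact/ofiltI.
Qed.

Lemma scattered0 V : scattered V [::].
Proof. by split=> //; apply/ofilt_pair_joins. Qed.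

Lemma scattered_take V B n : scattered V B -> scattered V (take n B).
Proof.
move=> [uB nVB /ofilt_pair_joins VB]; split; first exact: take_uniq.
  by move=> b /mem_take/nVB.
by apply/ofilt_pair_joins => x y /mem_take xB /mem_take yB; exact: VB.
Qed.

Lemma max_scattered_Pk V B k : scattered V B ->
    (forall B', scattered V B' -> (size B' <= size B)%N) -> (size B <= k)%N ->
  Pk k V.
Proof.
move=> sB maxB Bk.
have /choice[a aP] b : exists a, b \in B ->
    prime_elt a /\ forall y, (V : set K) (y `|` b)%O <-> ~ (y <= a)%O.
  case: (boolP (b \in B)) => [/(scattered_prime sB maxB)[a aP]|_]; last by exists b.
  by exists a.
exists [fset a b | b in B]%fset; split.
- by move=> _ /imfsetP[b /= bB ->]; have [] := aP b bB.
- by rewrite (leq_trans (leq_imfset_card _ _ _))//= (leq_trans (size_undup _)).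
- apply/seteqP; split=> y.
    move=> Vy [_ [/imfsetP[b /= bB ->]]]; have [_ aE] := aP b bB.
    by apply/aE; apply: ofilt_up Vy; exact: leUl.
  move=> nyA; apply: contrapT => nVy; have [uB nVB /ofilt_pair_joins VB] := sB.
  have Vyb b : b \in B -> (V : set K) (y `|` b)%O.
    move=> bB; have [_ aE] := aP b bB; apply/aE => yab; apply: nyA.
    by exists (a b); split=> //; apply/imfsetP; exists b.
  (* An element outside [V] but below none of the primes [a b] could be added to [B], against
     maximality. *)
  suff /maxB : scattered V (y :: B) by rewrite /= ltnn.
  split=> /=.
  - by rewrite uB andbT; apply/negP => /[dup] /Vyb; rewrite joinxx.
  - by move=> b; rewrite inE => /orP[/eqP->//|/nVB].
  - apply/ofilt_pair_joins => b c; rewrite !inE.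
    move=> /orP[/eqP->|bB] /orP[/eqP->|cB]; rewrite ?eqxx// => bc.
    + exact: Vyb.
    + by rewrite joinC; exact: Vyb.
    + exact: VB.
Qed.

(** Otherwise all scattered sequences have size at most [k], since longer ones could be truncated to
    [k.+1] entries; one of maximal size then puts [V] into [Pk k]. *)
Lemma not_Pk_scattered V k : ~ Pk k V -> exists2 B, size B = k.+1 & scattered V B.
Proof.
move=> nPk; apply: contrapT => nB.
have le_k B : scattered V B -> (size B <= k)%N.
  move=> sB; rewrite leqNgt; apply/negP => kB; apply: nB; exists (take k.+1 B).
    by rewrite size_take_min; apply/minn_idPl.
  exact: scattered_take.
pose P n := `[< exists2 B, size B = n & scattered V B >].
have exP : exists n, P n by exists 0%N; apply/asboolP; exists [::]; [|exact: scattered0].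
have leP n : P n -> (n <= k)%N by move=> /asboolP[B <-]; exact: le_k.
case: (ex_maxnP exP leP) => n /asboolP[B <- sB] maxn.
apply: nPk; apply: max_scattered_Pk sB _ (le_k B sB) => B' sB'.
by apply: maxn; apply/asboolP; exists B'.
Qed.

(** Pigeonhole: each entry of [B] lies below one of at most [k] primes. Two entries below the same
    prime have their join below it, hence outside [V]. *)
Lemma Pk_not_scattered V B k : Pk k V -> size B = k.+1 -> ~ scattered V B.
Proof.
move=> [A [_ Ak VA]] sB [uB nVB /ofilt_pair_joins VB].
have /choice[a aP] b : exists a, b \in B -> a \in A /\ (b <= a)%O.
  case: (boolP (b \in B)) => [/nVB|_]; last by exists b.
  by rewrite VA => /contrapT[a [aA ba]]; exists a.
suff : (size (map a B) <= size (enum_fset A))%N.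
  by rewrite size_map sB => /leq_trans/(_ Ak); rewrite ltnn.
apply: uniq_leq_size => [|_ /mapP[b bB ->]]; last by have [] := aP b bB.
rewrite map_inj_in_uniq// => b c bB cB abc; apply: contrapT => /eqP bc.
have : (V : set K) (c `|` b)%O by exact: VB.
rewrite VA; apply; exists (a b); have [aA ba] := aP b bB; split=> //.
by rewrite leUx ba andbT abc; have [] := aP c cB.
Qed.

(** Scott openness is used in one argument after the other. Membership of the join is kept as an
    implication so that [choice] yields a function on all pairs. *)
Lemma way_below_join V x y : exists p : K * K,
  [/\ way_below p.1 x, way_below p.2 y &
      (V : set K) (x `|` y)%O -> (V : set K) (p.1 `|` p.2)%O].
Proof.
have [Vxy|nVxy] := pselect ((V : set K) (x `|` y)%O); last first.
  have [[p px] _] := way_below_directed dom x.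
  by have [[q qy] _] := way_below_directed dom y; exists (p, q).
have [p [px]] := scott_open_joinl (way_below_directed dom x) (way_below_sup dom x) Vxy.
rewrite joinC => Vyp.
have [q [qy Vqp]] := scott_open_joinl (way_below_directed dom y) (way_below_sup dom y) Vyp.
by exists (p, q); split=> // _; rewrite joinC.
Qed.

Lemma way_below_seq_ub x (s : seq K) : {in s, forall z, way_below z x} ->
  exists2 u, way_below u x & {in s, forall z, (z <= u)%O}.
Proof.
have [[u0 u0x] dirx] := way_below_directed dom x.
elim: s => [_|z s IH sx]; first by exists u0.
have [|u ux su] := IH; first by move=> y ys; apply: sx; rewrite inE ys orbT.
have [v [vx uv zv]] := dirx u z ux (sx z (mem_head _ _)).
by exists v => // y; rewrite inE => /orP[/eqP->//|/su/le_trans]; exact.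
Qed.

(** [V] need not avoid [B] in the sense of [avoids]. Each [x] in [B] is lowered to some [f x] way
    below it, still large enough to keep the pairwise joins in [V]; these joins also keep the new
    elements distinct. *)
Lemma scattered_nbhs V B : scattered V B ->
  exists B', [/\ size B' = size B, uniq B' & nbhs V (scone (pair_joins B') B')].
Proof.
move=> [uB nVB /ofilt_pair_joins VB].
have /choice[p pP] (xy : K * K) := way_below_join V xy.1 xy.2.
have /choice[f fP] x : exists u, way_below u x /\
    {in B, forall y, ((p (x, y)).1 <= u)%O /\ ((p (y, x)).2 <= u)%O}.
  have [|u ux su] := @way_below_seq_ub x
    ([seq (p (x, y)).1 | y <- B] ++ [seq (p (y, x)).2 | y <- B]).
    move=> z; rewrite mem_cat => /orP[]/mapP[y _ ->].
      by have [] := pP (x, y).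
    by have [] := pP (y, x).
  exists u; split=> // y yB; split; apply: su; rewrite mem_cat.
    by rewrite (map_f (fun y => (p (x, y)).1)).
  by rewrite (map_f (fun y => (p (y, x)).2)) ?orbT.
have nVf x : x \in B -> ~ (V : set K) (f x).
  by move=> /nVB nVx Vfx; apply/nVx/(ofilt_up (way_belowW (fP x).1)).
have Vf : {in B &, forall x y, y != x -> (V : set K) (f x `|` f y)%O}.
  move=> x y xB yB yx; have [_ _ /(_ (VB x y xB yB yx))] := pP (x, y).
  apply: ofilt_up; apply: leU2; first by have [_ /(_ y yB)[]] := fP x.
  by have [_ /(_ x xB)[]] := fP y.
exists (map f B); split; first by rewrite size_map.
  rewrite map_inj_in_uniq// => x y xB yB fxy; apply: contrapT => /eqP xy.
  by apply: (nVf x xB); have := Vf y x yB xB xy; rewrite fxy joinxx.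
apply: (nbhs_scone dom top_compact mult).
  apply/ofilt_pair_joins => _ _ /mapP[x xB ->] /mapP[y yB ->] fxy.
  by apply: Vf => //; apply: contraNneq fxy => ->.
by move=> _ /mapP[x xB ->]; exists x; split; [have [] := fP x|exact: nVB].
Qed.

Lemma not_Pk_nbhs V k : ~ Pk k V ->
  exists B, [/\ size B = k.+1, uniq B & nbhs V (scone (pair_joins B) B)].
Proof.
by move=> /not_Pk_scattered[B <- /scattered_nbhs].
Qed.

Lemma scone_pair_joins_not_Pk k B : size B = k.+1 -> uniq B ->
  scone (pair_joins B) B `<=` ~` Pk k.
Proof. by move=> sB uB V [VB nVB] PV; exact: Pk_not_scattered PV sB _. Qed.

Lemma closed_Pk k : closed (@Pk _ K k).
Proof.
rewrite -openC openE => V /not_Pk_nbhs[B [sB uB]].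
by apply: filterS; exact: scone_pair_joins_not_Pk.
Qed.

End PrimeIntersections.

(** * Representing measures *)

Lemma borel_open (X : ptopologicalType) (U : set X) :
  open U -> measurable (U : set (borelType X)).
Proof. exact: sub_sigma_algebra. Qed.

Lemma borel_closed (X : ptopologicalType) (C : set X) :
  closed C -> measurable (C : set (borelType X)).
Proof.
by move=> cC; rewrite -(setCK C); apply: measurableC; apply: borel_open; exact: closed_openC.
Qed.

Section MeasuresOnOFilt.
Context {R : realType} {d : Order.disp_t} {K : tLatticeType d}.
Implicit Types (x y z a b : K) (V W : OFilt K) (A : seq K) (phi : K -> R)
  (mu nu : {measure set (borelType (OFilt K)) -> \bar R}).

Definition filters_at x : set (OFilt K) := [set V | (V : set K) x].

Lemma scone_nil x : scone x [::] = filters_at x.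
Proof. by apply/seteqP; split=> V //= [Vx]. Qed.

Lemma scone_cons x a A : scone x (a :: A) = scone x A `\` scone (x `&` a)%O A.
Proof.
apply/seteqP; split=> V.
  move=> [Vx VA]; split; last by move=> [/ofiltI[_ Va] _]; exact: VA (mem_head _ _) Va.
  by split=> // b bA; apply: VA; rewrite inE bA orbT.
move=> [[Vx VA] nVxa]; split=> // b; rewrite inE => /orP[/eqP->|/VA//].
by move=> Va; apply: nVxa; split=> //; exact/ofiltI.
Qed.

Lemma scone_sigma x A : <<s range filters_at >> (scone x A).
Proof.
rewrite -[X in X _]/(@measurable _ (g_sigma_algebraType (range filters_at))).
elim: A x => [|a A IH] x; last by rewrite scone_cons; exact: measurableD.
by rewrite scone_nil; apply: sub_sigma_algebra; exists x.
Qed.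

Lemma borel_filters_at x : measurable (filters_at x : set (borelType (OFilt K))).
Proof. by apply: borel_open; exact: open_mem. Qed.

Lemma borel_filters_sigma (B : set (borelType (OFilt K))) :
  <<s range filters_at >> B -> measurable B.
Proof.
move: B; apply: smallest_sub.
  exact: (@sigma_algebra_measurable _ (borelType (OFilt K))).
by move=> _ [x _ <-]; exact: borel_filters_at.
Qed.

Lemma borel_scone x A : measurable (scone x A : set (borelType (OFilt K))).
Proof. by apply: borel_filters_sigma; exact: scone_sigma. Qed.

Lemma measure_scone phi mu : (forall x, mu (filters_at x) = (phi x)%:E) ->
  forall A x, mu (scone x A) = (nabla_seq phi A x)%:E.
Proof.
move=> muE; elim=> [|a A IH] x; first by rewrite scone_nil muE.
have fin : (mu (scone x A) < +oo)%E by rewrite IH ltry.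
rewrite scone_cons measureD//; [|exact: borel_scone|exact: borel_scone].
rewrite nabla_seq_cons /nabla1 EFinB -!IH; congr (_ - mu _)%E.
by apply/seteqP; split=> V [] // /ofiltI[Vx Va] VA; split=> //; split=> //; exact/ofiltI.
Qed.

Context (dom : is_domain K).
Context (top_compact : way_below (\top%O : K) (\top%O : K)).
Context (mult : multiplicative_way_below K).

Lemma borel_compact (C : set (OFilt K)) :
  compact C -> measurable (C : set (borelType (OFilt K))).
Proof.
move=> cC; apply: borel_closed; apply: compact_closed cC.
exact: ofilt_hausdorff.
Qed.

(** The sets [filters_at x] form a pi-system, but the sigma-algebra they generate need not contain
    all open sets. It does contain finite unions of scones, which fit between a compact set and an
    open one; inner and then outer regularity extend the equality to Borel sets. *)
Lemma radon_filters_at_unique mu nu : is_radon mu -> is_radon nu ->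
  (forall x, mu (filters_at x) = nu (filters_at x)) ->
  (forall x, (mu (filters_at x) < +oo)%E) ->
  forall B : set (borelType (OFilt K)), measurable B -> mu B = nu B.
Proof.
move=> Rmu Rnu munu mufin.
have sigmaE M : <<s range filters_at >> M -> mu M = nu M.
  apply: (@g_sigma_algebra_measure_unique _ _ (borelType (OFilt K)) (range filters_at) _
    (fun=> filters_at \top%O)) => //.
  - by move=> _ [x _ <-]; exact: borel_filters_at.
  - by apply/seteqP; split=> // V _; exists 0%N => //; exact: ofilt_top.
  - move=> _ _ [x _ <-] [y _ <-]; exists (x `&` y)%O => //.
    by apply/seteqP; split=> V /ofiltI.
  - by move=> _ [x _ <-].
have le_open (mu1 mu2 : {measure set (borelType (OFilt K)) -> \bar R}) (U : set (OFilt K)) :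
    is_radon mu1 -> (forall M, <<s range filters_at >> M -> mu1 M = mu2 M) ->
    open U -> (mu1 U <= mu2 U)%E.
  move=> [_ inner _] mu12 oU; rewrite inner//; apply: ge_ereal_sup => _ [C [cC CU] <-].
  pose G N := exists M, [/\ <<s range filters_at >> M, N `<=` M & M `<=` U].
  have [|||p Cp|M [sM CM MU]] := @compact_ind _ G C cC.
  - exists set0; split=> //.
    exact: (@measurable0 _ (g_sigma_algebraType (range filters_at))).
  - move=> N N' [M [sM NM MU]] [M' [sM' NM' MU']]; exists (M `|` M'); split.
    + exact: (@measurableU _ (g_sigma_algebraType (range filters_at))).
    + exact: setUSS.
    + by rewrite subUset.
  - by move=> N N' NN' [M [sM NM MU]]; exists M; split=> //; exact: subset_trans NM.
  - have [x [A [px aA xAU]]] := nbhs_ofiltP dom top_compact mult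
      (open_nbhs_nbhs (conj oU (CU p Cp))).
    exists (scone x A); first exact: nbhs_scone.
    by exists (scone x A); split=> //; exact: scone_sigma.
  apply: (@le_trans _ _ (mu1 M)).
    by apply: le_measure; rewrite ?inE//; [exact: borel_compact|exact: borel_filters_sigma].
  rewrite mu12//.
  by apply: le_measure; rewrite ?inE//; [exact: borel_filters_sigma|exact: borel_open].
have openE U : open U -> mu U = nu U.
  move=> oU; apply/eqP; rewrite eq_le; apply/andP.
  by split; apply: le_open => // M /sigmaE.
move=> B mB; have [_ _ ->//] := Rmu; have [_ _ ->//] := Rnu; congr ereal_inf.
by apply/seteqP; split=> _ [U [oU BU] <-]; exists U => //; rewrite openE.
Qed.

(** A compact set of filters containing [x] is covered by the open sets [filters_at z] with [z] way
    below [x], and a single one suffices because these [z] are directed. *)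
Lemma radon_scott_function phi mu : is_radon mu ->
    (forall x, mu (filters_at x) = (phi x)%:E) -> phi \top%O = 1 ->
  scott_function phi.
Proof.
move=> [_ inner _] muE phi1.
have le_phi z x : (z <= x)%O -> phi z <= phi x.
  move=> zx; rewrite -lee_fin -!muE; apply: le_measure; rewrite ?inE;
    [exact: borel_filters_at|exact: borel_filters_at|].
  by move=> V; exact: ofilt_up.
split=> // x; first by rewrite -lee_fin -muE.
apply/eqP; rewrite eq_le; apply/andP; split; last first.
  by apply: ge_ereal_sup => _ [z /way_belowW zx <-]; rewrite lee_fin le_phi.
rewrite -muE inner; last exact: open_mem.
apply: ge_ereal_sup => _ [C [cC Cx] <-].
pose G N := exists2 z, way_below z x & N `<=` filters_at z.
have [[z0 z0x] dirx] := way_below_directed dom x.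
have [|||p Cp|z zx Cz] := @compact_ind _ G C cC.
- by exists z0.
- move=> M N [z zx Mz] [z' z'x Nz']; have [u [ux zu z'u]] := dirx z z' zx z'x.
  exists u => // V [/Mz|/Nz']; exact: ofilt_up.
- by move=> M N MN [z zx Nz]; exists z => //; exact: subset_trans Nz.
- have [z [zx pz]] := ofilt_way_below dom (Cx p Cp).
  exists (filters_at z); first by apply: open_nbhs_nbhs; split=> //; exact: open_mem.
  by exists z.
apply: (@le_trans _ _ (mu (filters_at z))).
  by apply: le_measure; rewrite ?inE//; [exact: borel_compact|exact: borel_filters_at].
by rewrite muE; apply: ereal_sup_ubound; exists z.
Qed.

Lemma all_nabla_ge0_cm phi : (forall x, 0 <= phi x) -> completely_monotone phi ->
  all_nabla_ge0 phi.
Proof.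
move=> phi0 [_ cm] [|s S] x; first exact: phi0.
rewrite nabla_seqE; apply: cm; apply/fset0Pn; exists s.
by rewrite in_fset mem_head.
Qed.

Lemma cm_scott_radon phi : scott_function phi -> completely_monotone phi ->
  exists mu, is_radon mu /\ forall x, mu (filters_at x) = (phi x)%:E.
Proof.
move=> [phi0 phi_sup _] cm.
have [m [m_ge0 mU m_ge m_le]] :=
  finitely_additive_content (way_above dom top_compact mult) (all_nabla_ge0_cm phi0 cm).
have [mu [Rmu muE]] := radon_extension (ofilt_hausdorff dom top_compact mult)
  (ofilt_compact dom top_compact mult) m_ge0 mU.
exists mu; split=> // x; rewrite muE; last exact: open_mem.
apply/eqP; rewrite eq_le; apply/andP; split.
  (* If [way_above y] lies in [C], it contains [x], so [y] is below [x] and the upper bound on [m]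
     applies. *)
  apply/inner_contentP => C _ Cx; rewrite lee_fin m_le// => y /Cx.
  exact: way_belowW.
(* For [z] way below [x], the closed set of filters including [way_above z] has mass at least
   [phi z] and lies inside [filters_at x]. *)
rewrite phi_sup; apply: ge_ereal_sup => _ [z zx <-].
apply: (@le_trans _ _ (m [set V : OFilt K | way_above dom top_compact mult z `<=` V])%:E).
  rewrite lee_fin m_ge// => y yz u zu; exact: le_way_below yz zu _.
apply: inner_content_ge; first exact: closed_way_above_sub.
by move=> V; exact.
Qed.

End MeasuresOnOFilt.

(** * Measures carried by [Pk k] and the valuation identity *)

Section Representations.
Context {R : realType} {d : Order.disp_t} {K : tDistrLatticeType d}.
Context (dom : is_domain K).
Context (top_compact : way_below (\top%O : K) (\top%O : K)).
Context (mult : multiplicative_way_below K).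
Implicit Types (k : nat) (phi : K -> R) (x : K)
  (mu : {measure set (borelType (OFilt K)) -> \bar R}).

Lemma borel_Pk k : measurable (@Pk _ K k : set (borelType (OFilt K))).
Proof. by apply: borel_closed; exact: closed_Pk. Qed.

Lemma measure_Pk_filters_at k mu x : mu (~` Pk k) = 0%E ->
  mu [set V : OFilt K | Pk k V /\ (V : set K) x] = mu (filters_at x).
Proof.
move=> mu0; rewrite -[X in mu X]/(Pk k `&` filters_at x).
have mP := borel_Pk k; have mx := borel_filters_at x.
apply/eqP; rewrite eq_le; apply/andP; split.
  by apply: le_measure; rewrite ?inE//; exact: measurableI.
rewrite -[leRHS]adde0 -mu0.
apply: le_trans (measureU2 _ _ _); last 2 first.
- exact: measurableI.
- exact: measurableC.
apply: le_measure; rewrite ?inE//.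
  by apply: measurableU; [exact: measurableI|exact: measurableC].
by move=> V Vx; have [PV|nPV] := pselect (Pk k V); [left|right].
Qed.

Lemma representsE k phi mu : represents k phi mu <->
  [/\ is_radon mu, mu (~` Pk k) = 0%E & forall x, mu (filters_at x) = (phi x)%:E].
Proof.
split=> -[Rmu mu0 muE]; split=> // x.
  by rewrite muE measure_Pk_filters_at.
by rewrite -muE -(measure_Pk_filters_at x mu0).
Qed.

(** The valuation identity expresses that the scone of [B] at its pairwise joins, which is disjoint
    from [Pk k], is a null set. *)
Lemma represents_k_valuation k phi mu : phi \top%O = 1 ->
  represents k phi mu -> k_valuation k phi.
Proof.
move=> phi1 /representsE[Rmu mu0 muE].
have sphi := radon_scott_function dom top_compact mult Rmu muE phi1.
have nablaE := measure_scone muE.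
split=> //; first split.
- move=> x y xy; rewrite -lee_fin -!muE; apply: le_measure; rewrite ?inE;
    [exact: borel_filters_at|exact: borel_filters_at|].
  by move=> V; exact: ofilt_up.
- by move=> A _ x; rewrite -lee_fin -nablaE.
move=> B sB; apply/EFin_inj; rewrite -nablaE; apply/eqP.
rewrite eq_le measure_ge0 andbT.
apply: (@le_trans _ _ (mu (~` Pk k))); last by rewrite mu0.
apply: le_measure; rewrite ?inE.
- exact: borel_scone.
- by apply: measurableC; exact: borel_Pk.
- by apply: scone_pair_joins_not_Pk => //; exact: fset_uniq.
Qed.

Lemma nabla_pair_joins k phi (B : seq K) : k_valuation k phi ->
  size B = k.+1 -> uniq B -> nabla_seq phi B (pair_joins B) = 0.
Proof.
move=> [_ _ val0] sB uB; pose F := [fset x in B]%fset.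
have FB : perm_eq (enum_fset F) B.
  by apply: uniq_perm => // x; rewrite in_fset.
have := val0 F; rewrite -nabla_seqE card_fseq undup_id// => /(_ sB).
suff -> : (\meet_(x <- F) \meet_(y <- F | y != x) (x `|` y))%O = pair_joins B by [].
by rewrite (perm_big _ FB); apply: eq_bigr => x _; rewrite (perm_big _ FB).
Qed.

(** By inner regularity only compact subsets of the open complement matter, and finitely many null
    scones cover each of them. *)
Lemma k_valuation_Pk0 k phi mu : is_radon mu -> k_valuation k phi ->
  (forall x, mu (filters_at x) = (phi x)%:E) -> mu (~` Pk k) = 0%E.
Proof.
move=> [_ inner _] val muE; apply/eqP; rewrite eq_le measure_ge0 andbT.
rewrite inner; last by rewrite openC; exact: closed_Pk.
apply: ge_ereal_sup => _ [C [cC CP] <-].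
(* A measurable null superset is required because the sets [N] met in the compactness argument need
   not be Borel. *)
pose G (N : set (OFilt K)) := exists2 M : set (borelType (OFilt K)),
  measurable M /\ mu M = 0%E & N `<=` M.
have [|||p Cp|M [mM muM0] CM] := @compact_ind _ G C cC.
- by exists set0; rewrite ?measure0.
- move=> N N' [M [mM muM] NM] [M' [mM' muM'] NM']; exists (M `|` M'); last exact: setUSS.
  split; first exact: measurableU.
  apply/eqP; rewrite eq_le measure_ge0 andbT.
  apply: (le_trans (measureU2 _ mM mM')).
  by rewrite [X in (X + _)%E]muM [X in (_ + X)%E]muM' adde0.
- by move=> N N' NN' [M mM NM]; exists M => //; exact: subset_trans NM.
- have [B [sB uB pB]] := not_Pk_nbhs dom top_compact mult (CP p Cp).
  exists (scone (pair_joins B) B) => //; exists (scone (pair_joins B) B) => //.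
  split; first exact: borel_scone.
  by rewrite (measure_scone muE) (nabla_pair_joins val).
rewrite -muM0; apply: le_measure; rewrite ?inE//.
exact: (borel_compact dom top_compact mult).
Qed.

End Representations.

(* Measures of the library are total functions on sets, so uniqueness is
   agreement on Borel sets. *)
Theorem theorem7p9 (R : realType) (d : Order.disp_t) (K : tDistrLatticeType d)
    (dom : is_domain K)
    (top_compact : way_below (\top%O : K) (\top%O : K))
    (mult : multiplicative_way_below K)
    (k : nat) (k_ge1 : (1 <= k)%N)
    (phi : K -> R) (phi_ge0 : forall x, 0 <= phi x) (phi_top : phi \top%O = 1) :
  (exists mu : {measure set (borelType (OFilt K)) -> \bar R},
      represents k phi mu /\
      forall nu : {measure set (borelType (OFilt K)) -> \bar R},
        represents k phi nu ->
        forall B : set (borelType (OFilt K)), measurable B -> nu B = mu B)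
  <-> k_valuation k phi.
Proof.
split=> [[mu [rmu _]]|val]; first exact: represents_k_valuation rmu.
have [sphi cm _] := val.
have [mu [Rmu muE]] := cm_scott_radon dom top_compact mult sphi cm.
have mu0 := k_valuation_Pk0 dom top_compact mult Rmu val muE.
exists mu; split; first by apply/(representsE dom top_compact mult); split.
move=> nu /(representsE dom top_compact mult)[Rnu _ nuE].
apply: radon_filters_at_unique => // x; first by rewrite muE.
by rewrite nuE ltry.
Qed.
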